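(* For all $y,y^+\in\mathbb Y_{\mathcal V}$, the configuration-constrained polytopes $P(Y,y)$ and $P(Y,y^+)$ satisfy $$P(Y,y^+)\in F(P(Y,y))$$ if and only if $(y,y^+)\in\mathcal F$.
   Context: Setting: $\mathbb U\subseteq\mathbb R^{n_u}$ is closed and convex, $\mathbb W\subseteq\mathbb R^{n_w}$ is non-empty and compact, $C\in\mathbb R^{n_x\times n_w}$ is a given matrix, and $\Delta=\mathrm{conv}([\overline A_1,\overline B_1],\ldots,[\overline A_l,\overline B_l])\subseteq\mathbb R^{n_x\times(n_x+n_u)}$ is a matrix polytope with given vertices ($\overline A_j\in\mathbb R^{n_x\times n_x}$, $\overline B_j\in\mathbb R^{n_x\times n_u}$). For $X\subseteq\mathbb R^{n_x}$ define the set of sets $$F(X)=\{X^+\subseteq\mathbb R^{n_x} : \forall x\in X\ \exists u\in\mathbb U\ \forall [A,B]\in\Delta\ \forall w\in\mathbb W,\ Ax+Bu+Cw\in X^+\}.$$ Polytopes: let $Y\in\mathbb R^{m\times n}$ with $n=n_x$, and $P(Y,y)=\{x\in\mathbb R^n: Yx\le y\}$. For $I\subseteq\{1,\ldots,m\}$, $Y_I,y_I$ denote the rows/entries with index in $I$, and $\mathcal F_I(y)=\{x\in P(Y,y):Y_Ix\ge y_I\}$. $P(Y,y)$ is entirely simple if every $I$ with $\mathcal F_I(y)\ne\varnothing$ satisfies $\mathrm{rank}(Y_I)=|I|$. Let $\sigma\in\mathbb R^m$ be such that $P(Y,\sigma)$ is a non-empty entirely simple polytope (bounded polyhedron). Let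 $\mathcal V=\{\mathcal V_1,\ldots,\mathcal V_{\overline m}\}$ be the collection of all $I$ with $|I|=n$ and $\mathcal F_I(\sigma)\ne\varnothing$, let $V_i\in\mathbb R^{n\times m}$ be the matrix with $V_iy=Y_{\mathcal V_i}^{-1}y_{\mathcal V_i}$ for all $y\in\mathbb R^m$, let $E$ be the matrix obtained by stacking the blocks $YV_i-\mathbb 1$ ($\mathbb 1$ the $m\times m$ identity), $i=1,\ldots,\overline m$, and let $\mathbb Y_{\mathcal V}=\{y\in\mathbb R^m: Ey\le0\}$. Let $\overline w\in\mathbb R^m$ have components $\overline w_i=\max_{w\in\mathbb W}Y_iCw$, where $Y_i$ is the $i$-th row of $Y$. Define $$\mathcal F=\{(y,y^+)\in\mathbb Y_{\mathcal V}\times\mathbb Y_{\mathcal V} : \exists u_1,\ldots,u_{\overline m}\in\mathbb U \text{ such that } Y\overline A_jV_iy+Y\overline B_ju_i+\overline w\le y^+\ \text{for all } i\in\{1,\ldots,\overline m\},\ j\in\{1,\ldots,l\}\}.$$ *)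

(* Defs.v *)
From mathcomp Require Import all_boot all_order all_algebra.
From mathcomp Require Import all_classical all_reals all_analysis.

Set Implicit Arguments.
Unset Strict Implicit.
Unset Printing Implicit Defensive.

Import Order.TTheory GRing.Theory Num.Theory numFieldNormedType.Exports.

Local Open Scope classical_set_scope.
Local Open Scope ring_scope.

Reserved Notation "x <=v y" (at level 70, y at next level).

Definition cvle (R : realType) (k : nat) (x y : 'cV[R]_k) : Prop :=
  forall i : 'I_k, x i 0 <= y i 0.

Notation "x <=v y" := (cvle x y) : ring_scope.

Definition conv_family (R : realType) (V : lmodType R) (l : nat)
    (v : 'I_l -> V) : set V :=
  [set z | exists a : 'I_l -> R,
     [/\ forall j, 0 <= a j, \sum_(j < l) a j = 1 &
         z = \sum_(j < l) a j *: v j]].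

(* The block matrix written [A, B] in the mathematics is [row_mx A B]. *)
Definition mx_polytope (R : realType) (nx nu l : nat)
    (Abar : 'I_l -> 'M[R]_nx) (Bbar : 'I_l -> 'M[R]_(nx, nu)) :
    set 'M[R]_(nx, nx + nu) :=
  conv_family (fun j => row_mx (Abar j) (Bbar j)).

Definition robust_successors (R : realType) (nx nu nw : nat)
    (U : set 'cV[R]_nu) (W : set 'cV[R]_nw) (C : 'M[R]_(nx, nw))
    (Delta : set 'M[R]_(nx, nx + nu)) (X : set 'cV[R]_nx) :
    set (set 'cV[R]_nx) :=
  [set Xp | forall x, X x -> exists2 u, U u &
     forall (A : 'M[R]_nx) (B : 'M[R]_(nx, nu)), Delta (row_mx A B) ->
     forall w, W w -> Xp (A *m x + B *m u + C *m w)].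

Definition polyhedron (R : realType) (m n : nat) (Y : 'M[R]_(m, n))
    (y : 'cV[R]_m) : set 'cV[R]_n :=
  [set x | Y *m x <=v y].

(* M_I: the rows of M with index in I, in increasing order. *)
Definition rows_in (R : realType) (m k : nat) (I : {set 'I_m})
    (M : 'M[R]_(m, k)) : 'M[R]_(#|I|, k) :=
  rowsub (fun i : 'I_#|I| => enum_val i) M.

Definition face (R : realType) (m n : nat) (Y : 'M[R]_(m, n)) (y : 'cV[R]_m)
    (I : {set 'I_m}) : set 'cV[R]_n :=
  [set x | polyhedron Y y x /\ rows_in I y <=v rows_in I Y *m x].

Definition entirely_simple (R : realType) (m n : nat) (Y : 'M[R]_(m, n))
    (y : 'cV[R]_m) : Prop :=
  forall I : {set 'I_m}, face Y y I !=set0 -> \rank (rows_in I Y) = #|I|.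

Definition vertex_sets (R : realType) (m n : nat) (Y : 'M[R]_(m, n))
    (sigma : 'cV[R]_m) : {set {set 'I_m}} :=
  [set I : {set 'I_m} | (#|I| == n) && `[< face Y sigma I !=set0 >]]%SET.

(* The matrix of y |-> Y_I^-1 y_I for #|I| = n.  In that case [conform_mx 0]
   only casts matrices with #|I| rows to matrices with n rows; the selection
   y |-> y_I is multiplication by the rows of the identity with index in I. *)
Definition vertex_mx (R : realType) (m n : nat) (Y : 'M[R]_(m, n))
    (I : {set 'I_m}) : 'M[R]_(n, m) :=
  invmx (conform_mx (0 : 'M[R]_n) (rows_in I Y)) *m
  conform_mx (0 : 'M[R]_(n, m)) (rows_in I (1%:M : 'M[R]_m)).

Lemma vertex_mxE (R : realType) (m n : nat) (Y : 'M[R]_(m, n))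
    (I : {set 'I_m}) (y : 'cV[R]_m) : #|I| = n ->
  vertex_mx Y I *m y =
  invmx (conform_mx (0 : 'M[R]_n) (rows_in I Y)) *m
  conform_mx (0 : 'cV[R]_n) (rows_in I y).
Proof.
move=> In; subst n.
by rewrite /vertex_mx !conform_mx_id -mulmxA /rows_in mul_rowsub_mx mul1mx.
Qed.

Lemma rows_in_vertex_mx (R : realType) (m n : nat) (Y : 'M[R]_(m, n))
    (I : {set 'I_m}) (y : 'cV[R]_m) : #|I| = n ->
  \rank (rows_in I Y) = #|I| ->
  rows_in I Y *m (vertex_mx Y I *m y) = rows_in I y.
Proof.
move=> In rI; rewrite vertex_mxE//; subst n.
rewrite !conform_mx_id mulKVmx// -row_free_unit.
by rewrite /row_free rI.
Qed.

(* V_i, where i indexes the enumeration of the collection [vertex_sets]. *)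
Definition Vmx (R : realType) (m n : nat) (Y : 'M[R]_(m, n))
    (sigma : 'cV[R]_m) (i : 'I_#|vertex_sets Y sigma|) : 'M[R]_(n, m) :=
  vertex_mx Y (enum_val i).

Definition config_mx (R : realType) (m n : nat) (Y : 'M[R]_(m, n))
    (sigma : 'cV[R]_m) :
    'M[R]_(\sum_(i < #|vertex_sets Y sigma|) m, m) :=
  \mxcol_(i < #|vertex_sets Y sigma|) (Y *m Vmx i - 1%:M).

Definition config_cone (R : realType) (m n : nat) (Y : 'M[R]_(m, n))
    (sigma : 'cV[R]_m) : set 'cV[R]_m :=
  [set y | config_mx Y sigma *m y <=v 0].

(* The greatest element of S; the junk value 0 if there is none. *)
Definition set_max (R : realType) (S : set R) : R := xget 0 (S `&` ubound S).

Definition wbar (R : realType) (m n nw : nat) (Y : 'M[R]_(m, n))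
    (C : 'M[R]_(n, nw)) (W : set 'cV[R]_nw) : 'cV[R]_m :=
  \col_(i < m) set_max [set (row i Y *m C *m w) 0 0 | w in W].

Lemma wbar_max (R : realType) (m n nw : nat) (Y : 'M[R]_(m, n))
    (C : 'M[R]_(n, nw)) (W : set 'cV[R]_nw) (i : 'I_m) :
  W !=set0 -> compact W ->
  (exists2 w, W w & wbar Y C W i 0 = (row i Y *m C *m w) 0 0) /\
  (forall w, W w -> (row i Y *m C *m w) 0 0 <= wbar Y C W i 0).
Proof.
move=> W0 cW; pose f (w : 'cV[R]_nw) : R := (row i Y *m C *m w) 0 0.
have fc : continuous f.
  have fE : f = fun w => \sum_j (row i Y *m C) 0 j * w j 0.
    by apply/funext => w; rewrite /f mxE.
  rewrite fE; move: (index_enum _) => r; elim: r => [|j r IHr].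
    have -> : (fun w : 'cV[R]_nw => \sum_(j <- [::]) (row i Y *m C) 0 j * w j 0)
        = cst 0 by apply/funext => w; rewrite big_nil.
    exact: cst_continuous.
  have -> : (fun w : 'cV[R]_nw => \sum_(k <- j :: r) (row i Y *m C) 0 k * w k 0)
      = (fun w => (row i Y *m C) 0 j * w j 0) \+
        (fun w => \sum_(k <- r) (row i Y *m C) 0 k * w k 0).
    by apply/funext => w; rewrite big_cons.
  move=> w; have FF : Filter (nbhs w) by exact: nbhs_filter.
  apply: cvgD; last exact: IHr.
  by apply: cvgM; [exact: cvg_cst|exact: coord_continuous].
have [c cW' cmax] :
    exists2 c, c \in W & forall t, t \in W -> f t <= f c.
  by apply: compact_EVT_max => //; exact: continuous_subspaceT.
have : ([set f w | w in W] `&` ubound [set f w | w in W]) (wbar Y C W i 0).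
  rewrite mxE /set_max; case: xgetP => [x -> //|/(_ (f c))]; case.
  split; first by exists c => //; exact: set_mem.
  by move=> _ [t Wt <-]; apply: cmax; exact: mem_set.
by case=> -[w Ww <-] ub; split; [exists w|move=> t Wt; apply: ub; exists t].
Qed.

Definition robust_pairs (R : realType) (m n nu nw l : nat)
    (U : set 'cV[R]_nu) (W : set 'cV[R]_nw) (C : 'M[R]_(n, nw))
    (Abar : 'I_l -> 'M[R]_n) (Bbar : 'I_l -> 'M[R]_(n, nu))
    (Y : 'M[R]_(m, n)) (sigma : 'cV[R]_m) : set ('cV[R]_m * 'cV[R]_m) :=
  [set p | [/\ config_cone Y sigma p.1, config_cone Y sigma p.2 &
     exists u : 'I_#|vertex_sets Y sigma| -> 'cV[R]_nu,
       (forall i, U (u i)) /\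
       forall i j, Y *m Abar j *m Vmx i *m p.1 + Y *m Bbar j *m u i +
                   wbar Y C W <=v p.2]].

(* Main.v *)
Require Import Defs.
From mathcomp Require Import all_boot all_order all_algebra.
From mathcomp Require Import all_classical all_reals all_analysis.

Set Implicit Arguments.
Unset Strict Implicit.
Unset Printing Implicit Defensive.

Import Order.TTheory GRing.Theory Num.Theory numFieldNormedType.Exports.

Local Open Scope classical_set_scope.
Local Open Scope ring_scope.

(* A point outside the convex hull of the points V_i y is separated from it by
   some c (Farkas).  The maximum of c over the bounded polyhedron P(Y, sigma) is
   attained at a vertex V_i sigma, and simplicity makes c = a Y_I with a >= 0,
   where I is the i-th vertex set.  Hence c x <= a y_I = c V_i y on P(Y, y) for
   every y, so P(Y, y) is contained in the hull of the V_i y; Ey <= 0 says that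
   the V_i y lie in P(Y, y).  Inputs at the vertices then extend to all of
   P(Y, y) by convexity, and extreme disturbances are absorbed by wbar. *)

Local Notation "c '⋅' x" := ((c *m x) 0 0) (at level 40, left associativity).

(** * Farkas' lemma and separation from a convex hull *)

Lemma dotDZr (R : realFieldType) n (c : 'rV[R]_n) (x z : 'cV[R]_n) t :
  c ⋅ (x + t *: z) = c ⋅ x + t * (c ⋅ z).
Proof. by rewrite mulmxDr -scalemxAr mxE [X in _ + X]mxE. Qed.

Lemma dotDZl (R : realFieldType) n (c d : 'rV[R]_n) (x : 'cV[R]_n) t :
  (c + t *: d) ⋅ x = c ⋅ x + t * (d ⋅ x).
Proof. by rewrite mulmxDl -scalemxAl mxE [X in _ + X]mxE. Qed.

(* Gale's induction: if c separates b from the first k generators but not from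
   the last one a0, project everything along a0 onto the kernel of c. *)
Lemma farkas (R : realFieldType) n k (a : 'I_k -> 'cV[R]_n) (b : 'cV[R]_n) :
  (exists2 t : 'I_k -> R, forall i, 0 <= t i & b = \sum_i t i *: a i) \/
  (exists2 c : 'rV[R]_n, forall i, c ⋅ a i <= 0 & 0 < c ⋅ b).
Proof.
elim: k a b => [|k IHk] a b.
  have [->|bN0] := eqVneq b 0.
    by left; exists (fun=> 0) => //; rewrite big_ord0.
  right; exists b^T => [[]//|].
  have [i bi0] : exists i, b i 0 != 0.
    apply/existsP; apply: contraNT bN0 => /existsPn b0.
    by apply/eqP/matrixP => i j; rewrite ord1 mxE; apply/eqP/negbNE/b0.
  rewrite mxE (bigD1 i)//= ltr_pwDl//.
    by rewrite mxE -expr2 exprn_even_gt0.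
  by apply: sumr_ge0 => j _; rewrite mxE -expr2 sqr_ge0.
have [[t t0 ->]|[c ca cb]] := IHk (fun i => a (lift ord0 i)) b.
  left; exists (fun i => oapp t 0 (unlift ord0 i)).
    by move=> i; case: unliftP => //=.
  rewrite big_ord_recl unlift_none scale0r add0r.
  by apply: eq_bigr => i _; rewrite liftK.
have [ca0|ca0] := lerP (c ⋅ a ord0) 0.
  right; exists c => // i.
  by case: (unliftP ord0 i) => [j|] ->.
have ca0N0 : c ⋅ a ord0 != 0 by rewrite gt_eqF.
pose p v := v + - (c ⋅ v / (c ⋅ a ord0)) *: a ord0.
have [[t t0 pb]|[d da db]] := IHk (fun i => p (a (lift ord0 i))) (p b).
  (* Undoing the projection leaves this coefficient on [a ord0]. It is nonnegative: [c] is positive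
     on [b] and [a ord0], nonpositive on the other generators. *)
  pose s := c ⋅ b / (c ⋅ a ord0)
    - \sum_i t i * (c ⋅ a (lift ord0 i) / (c ⋅ a ord0)).
  left; exists (fun i => oapp t s (unlift ord0 i)).
    move=> i; case: unliftP => //= _; rewrite subr_ge0.
    apply: (@le_trans _ _ 0); last by rewrite divr_ge0// ltW.
    apply: sumr_le0 => j _.
    by rewrite mulr_ge0_le0// pmulr_lle0// invr_gt0.
  rewrite big_ord_recl unlift_none/=.
  under eq_bigr do rewrite liftK/=.
  rewrite /p in pb; move/eqP: pb; rewrite scaleNr subr_eq => /eqP ->.
  rewrite /s scalerBl -addrA [RHS]addrC; congr (_ + _).
  rewrite addrC scaler_suml -sumrB; apply: eq_bigr => i _.
  by rewrite scalerDr scalerA mulrN scaleNr.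
pose e := d + - (d ⋅ a ord0 / (c ⋅ a ord0)) *: c.
have eE v : e ⋅ v = d ⋅ p v.
  rewrite dotDZl dotDZr !mulNr; congr (_ - _).
  by rewrite mulrAC [RHS]mulrAC; congr (_ / _); rewrite mulrC.
right; exists e => [i|]; last by rewrite eE.
case: (unliftP ord0 i) => [j|] ->; first by rewrite eE.
by rewrite dotDZl mulNr divfK// subrr.
Qed.

(** Farkas' lemma at height one: the appended coordinate 1 makes the weights sum to 1, and the last
    entry of the separating row adds the same constant to both sides. *)
Lemma conv_family_or_separated (R : realType) n k (v : 'I_k -> 'cV[R]_n)
    (x : 'cV[R]_n) :
  conv_family v x \/ exists c : 'rV[R]_n, forall i, c ⋅ v i < c ⋅ x.
Proof.
pose lift1 (z : 'cV[R]_n) : 'cV[R]_(n + 1) := col_mx z 1.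
have [[t t0 xE]|[c cv cx]] := farkas (lift1 \o v) (lift1 x).
  left; exists t; split=> //.
    have := congr1 (fun z => dsubmx z 0 0) xE.
    rewrite /= col_mxKd linear_sum summxE mxE eqxx => /esym; apply: etrans.
    by apply: eq_bigr => i _; rewrite !linearZ/= col_mxKd !mxE mulr1.
  rewrite -[x in LHS](col_mxKu x 1) -/(lift1 x) xE linear_sum/=.
  by apply: eq_bigr => i _; rewrite linearZ/= col_mxKu.
right; exists (lsubmx c) => i.
have lift1E z : c ⋅ lift1 z = lsubmx c ⋅ z + rsubmx c 0 0.
  by rewrite -{1}(hsubmxK c) mul_row_col mulmx1 mxE.
have := le_lt_trans (cv i) cx.
by rewrite /= !lift1E ltrD2r.
Qed.

(** * Active constraints and the passage to a vertex *)

Definition active (R : realType) m n (Y : 'M[R]_(m, n)) (y : 'cV[R]_m)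
    (x : 'cV[R]_n) : {set 'I_m} :=
  [set i | (Y *m x) i 0 == y i 0]%SET.

Lemma face_active (R : realType) m n (Y : 'M[R]_(m, n)) (y : 'cV[R]_m) x :
  polyhedron Y y x -> face Y y (active Y y x) x.
Proof.
move=> Px; split=> // i; rewrite mul_rowsub_mx !mxE.
by have := enum_valP i; rewrite inE mxE => /eqP ->.
Qed.

Lemma face_sub_active (R : realType) m n (Y : 'M[R]_(m, n)) (y : 'cV[R]_m) I x :
  face Y y I x -> I \subset active Y y x.
Proof.
case=> Px Ix; apply/fintype.subsetP => i iI; rewrite inE eq_le Px/=.
have := Ix (enum_rank_in iI i).
by rewrite mul_rowsub_mx !mxE enum_rankK_in.
Qed.

Lemma rows_in_face (R : realType) m n (Y : 'M[R]_(m, n)) (y : 'cV[R]_m) I x :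
  face Y y I x -> rows_in I Y *m x = rows_in I y.
Proof.
move=> /face_sub_active/fintype.subsetP Ix; apply/colP => i.
rewrite mul_rowsub_mx !mxE; have := Ix _ (enum_valP i).
by rewrite inE mxE => /eqP.
Qed.

Lemma row_deficient_ker (R : fieldType) p n (A : 'M[R]_(p, n)) :
  (\rank A < n)%N -> exists2 d : 'cV[R]_n, d != 0 & A *m d = 0.
Proof.
move=> An; have : kermx A^T != 0.
  by rewrite -mxrank_eq0 mxrank_ker mxrank_tr subn_eq0 -ltnNge.
case/rowV0Pn => v /sub_kermxP vA v0; exists v^T.
  by apply: contraNneq v0 => v0; rewrite -[v]trmxK v0 trmx0.
by apply: trmx_inj; rewrite trmx_mul trmxK vA trmx0.
Qed.

Lemma bounded_polyhedron_blocks (R : realType) m n (Y : 'M[R]_(m, n))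
    (y : 'cV[R]_m) (x d : 'cV[R]_n) :
  bounded_set (polyhedron Y y) -> polyhedron Y y x -> d != 0 ->
  exists i, 0 < (Y *m d) i 0.
Proof.
move=> bP Px d0; apply: contrapT => dN.
have [M M0 PM] := ex_strict_bound_gt0 bP.
have dgt0 : 0 < `|d| by rewrite normr_gt0.
(* The displacement [t *: d] gets norm [M + |x| + 1], whereas staying in the ball of radius [M]
   allows at most [M + |x|]. *)
pose t := (M + `|x| + 1) / `|d|.
have t0 : 0 <= t by rewrite divr_ge0// !addr_ge0// ltW.
have Pxt : polyhedron Y y (x + t *: d).
  move=> i; rewrite mulmxDr -scalemxAr mxE [X in _ + X]mxE.
  rewrite -[leRHS]addr0 lerD//.
  by rewrite mulr_ge0_le0// leNgt; apply/negP => di; apply: dN; exists i.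
have : `|t *: d| <= M + `|x|.
  rewrite -[t *: d](addKr x) (le_trans (ler_normD _ _))// addrC normrN.
  by rewrite lerD2r; exact/ltW/PM.
by rewrite normrZ ger0_norm// divfK ?gt_eqF// gerDl ler10.
Qed.

(** While the active rows have rank below [n], some kernel direction does not decrease [c];
    following it until a new constraint becomes tight enlarges the active set. Simplicity equates
    the rank with the number of active rows, so the process stops at exactly [n]. *)
Lemma push_to_vertex (R : realType) m n (Y : 'M[R]_(m, n)) (y : 'cV[R]_m)
    (c : 'rV[R]_n) x :
  bounded_set (polyhedron Y y) -> entirely_simple Y y -> polyhedron Y y x ->
  exists x', [/\ polyhedron Y y x', c ⋅ x <= c ⋅ x' &
                 #|active Y y x'| = n].
Proof.
move=> bP sP; have [k] := ubnP (n - #|active Y y x|)%N.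
elim: k x => // k IHk x xk Px.
have rkE := sP _ (ex_intro _ x (face_active Px)).
have := rank_leq_col (rows_in (active Y y x) Y); rewrite leq_eqVlt.
case/orP => [/eqP rkn|rkn]; first by exists x; rewrite -rkE.
have [d [d0 Yd cd]] : exists d : 'cV[R]_n, [/\ d != 0,
    rows_in (active Y y x) Y *m d = 0 & 0 <= c ⋅ d].
  have [d d0 Yd] := row_deficient_ker rkn.
  have [cd|cd] := lerP 0 (c ⋅ d); first by exists d.
  exists (- d); split; rewrite ?oppr_eq0 ?mulmxN ?Yd ?oppr0//.
  by rewrite mxE oppr_ge0 ltW.
have {}Yd i : i \in active Y y x -> (Y *m d) i 0 = 0.
  move=> ix; move/matrixP: Yd => /(_ (enum_rank_in ix i) 0).
  by rewrite mul_rowsub_mx mxE enum_rankK_in// => ->; rewrite mxE.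
have [i0 di0] := bounded_polyhedron_blocks bP Px d0.
(* Ratio test: the smallest ratio over the rows that increase along [d] is the largest feasible
   step, and its row becomes active. *)
pose ratio i := (y i 0 - (Y *m x) i 0) / (Y *m d) i 0.
have [i /= di imin] := @arg_minP _ _ _ i0 (fun i => 0 < (Y *m d) i 0) ratio di0.
have t0 : 0 <= ratio i by rewrite divr_ge0 ?(ltW di)// subr_ge0; exact: Px.
pose x' := x + ratio i *: d.
have Yx' j : (Y *m x') j 0 = (Y *m x) j 0 + ratio i * (Y *m d) j 0.
  by rewrite mulmxDr -scalemxAr mxE [X in _ + X]mxE.
have Px' : polyhedron Y y x'.
  move=> j; rewrite Yx'; have [dj|dj] := ltrP 0 ((Y *m d) j 0).
    by rewrite -lerBrDl -ler_pdivlMr// imin.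
  by rewrite -[leRHS]addr0 lerD ?mulr_ge0_le0//; exact: Px.
have xx' : active Y y x \proper active Y y x'.
  apply/properP; split.
    apply/fintype.subsetP => j jx; rewrite inE Yx' Yd// mulr0 addr0.
    by rewrite inE in jx.
  exists i; first by rewrite inE Yx' /ratio divfK ?(gt_eqF di)// addrC subrK.
  by apply: contraTN di => /Yd ->; rewrite ltxx.
have [] := IHk x' _ Px'.
  rewrite -ltnS (leq_trans _ xk)// ltnS ltn_sub2l ?proper_card//.
  by rewrite -rkE.
move=> x'' [Px'' cx'' x''n]; exists x''; split=> //.
by rewrite (le_trans _ cx'')// dotDZr lerDl mulr_ge0.
Qed.

Lemma vertex_setsP (R : realType) m n (Y : 'M[R]_(m, n)) (sigma : 'cV[R]_m)
    (I : {set 'I_m}) :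
  reflect (#|I| = n /\ face Y sigma I !=set0) (I \in vertex_sets Y sigma).
Proof. by rewrite inE; apply: (iffP andP) => -[/eqP In /asboolP FI]. Qed.

(** The inverse of [1 + \sum_i |r i| / s i] replaces a minimum of ratios. *)
Lemma exists_step (R : realFieldType) k (s r : 'I_k -> R) : (forall i, 0 < s i) ->
  exists2 t, 0 < t & forall i, t * r i <= s i.
Proof.
move=> s0; pose q := 1 + \sum_i `|r i| / s i.
have t0 i : 0 <= `|r i| / s i by rewrite divr_ge0// ltW.
have q0 : 0 < q by rewrite ltr_pwDl// sumr_ge0.
exists q^-1; rewrite ?invr_gt0// => i.
rewrite mulrC ler_pdivrMr// mulrC -ler_pdivrMr//.
apply: (@le_trans _ _ (`|r i| / s i)).
  by rewrite ler_pM2r ?invr_gt0// ler_norm.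
by rewrite /q (bigD1 i)//= addrCA lerDl addr_ge0// sumr_ge0//.
Qed.

(** * Vertices of an entirely simple polytope *)

Section simple_polytope.
Variables (R : realType) (m n : nat) (Y : 'M[R]_(m, n)) (sigma : 'cV[R]_m).
Hypothesis P_simple : entirely_simple Y sigma.
Implicit Types (i : 'I_#|vertex_sets Y sigma|) (x : 'cV[R]_n) (y : 'cV[R]_m).

Let VY i := rows_in (enum_val i) Y.

Lemma card_vertex i : #|enum_val i| = n.
Proof. by have /vertex_setsP[] := enum_valP i. Qed.

Lemma rank_vertex i : \rank (VY i) = #|enum_val i|.
Proof. by have /vertex_setsP[_] := enum_valP i; exact: P_simple. Qed.

Lemma vertex_row_full i : row_full (VY i).
Proof. by rewrite /row_full rank_vertex card_vertex. Qed.

Lemma vertex_row_free i : row_free (VY i).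
Proof. by rewrite /row_free rank_vertex. Qed.

Lemma rows_in_Vmx i y : VY i *m (Vmx i *m y) = rows_in (enum_val i) y.
Proof. by rewrite rows_in_vertex_mx ?card_vertex ?rank_vertex. Qed.

Lemma Vmx_face i x : face Y sigma (enum_val i) x -> x = Vmx i *m sigma.
Proof.
move=> Fx; apply: (row_full_inj (vertex_row_full i)).
by rewrite rows_in_Vmx; exact: rows_in_face.
Qed.

Lemma face_Vmx i : face Y sigma (enum_val i) (Vmx i *m sigma).
Proof.
have /vertex_setsP[_ [x Fx]] := enum_valP i.
by rewrite -(Vmx_face Fx).
Qed.

(** A further active constraint would, by simplicity, push the rank of the active rows above the
    number [n] of columns. *)
Lemma active_Vmx i : active Y sigma (Vmx i *m sigma) = enum_val i.
Proof.
apply/esym/eqP; rewrite finset.eqEcard face_sub_active; last exact: face_Vmx.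
have Px := (face_Vmx i).1; have Fx := face_active Px.
have := rank_leq_col (rows_in (active Y sigma (Vmx i *m sigma)) Y).
by rewrite P_simple ?card_vertex//; exists (Vmx i *m sigma).
Qed.

Hypothesis P_neq0 : polyhedron Y sigma !=set0.
Hypothesis P_bounded : bounded_set (polyhedron Y sigma).

(** Every point is dominated by a vertex, so the best of the finitely many vertices is a
    maximizer. *)
Lemma exists_max_vertex (c : 'rV[R]_n) : exists i, forall x,
  polyhedron Y sigma x -> c ⋅ x <= c ⋅ (Vmx i *m sigma).
Proof.
have pushV x : polyhedron Y sigma x -> exists i, c ⋅ x <= c ⋅ (Vmx i *m sigma).
  move=> Px; have [x' [Px' cx' x'n]] := push_to_vertex c P_bounded P_simple Px.
  have Fx' := face_active Px'.
  have Ix' : active Y sigma x' \in vertex_sets Y sigma.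
    by apply/vertex_setsP; split=> //; exists x'.
  exists (enum_rank_in Ix' (active Y sigma x')).
  by rewrite -(@Vmx_face _ x')// enum_rankK_in.
have [x0 Px0] := P_neq0; have [i0 _] := pushV _ Px0.
have [i _ imax] := @arg_maxP _ _ _ i0 xpredT (fun i => c ⋅ (Vmx i *m sigma)) isT.
exists i => x Px; have [j xj] := pushV _ Px.
exact: le_trans xj (imax j isT).
Qed.

(* The vertex maximizing c over P(Y, sigma) has c in the cone of its active
   rows: otherwise one could leave a single active facet while increasing c. *)
Lemma vertex_cone (c : 'rV[R]_n) : exists i,
  exists2 a : 'rV[R]_#|enum_val i|, forall k, 0 <= a 0 k & c = a *m VY i.
Proof.
have [i imax] := exists_max_vertex c; exists i; set x := Vmx i *m sigma in imax.
have ci : c = (c *m pinvmx (VY i)) *m VY i.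
  by rewrite mulmxKpV// submx_full// vertex_row_full.
exists (c *m pinvmx (VY i)) => // k.
set a := c *m pinvmx (VY i) in ci *; rewrite leNgt; apply/negP => ak.
(* Along [d] the [k]-th active row decreases and the others stay tight, while [c] grows at the rate
   [- a 0 k > 0]. *)
pose d := pinvmx (VY i) *m - delta_mx k 0 : 'cV[R]_n.
have Yd : VY i *m d = - delta_mx k 0.
  by rewrite mulmxA mulmxVp ?mul1mx// vertex_row_free.
have cd : 0 < c ⋅ d.
  by rewrite ci -mulmxA Yd mulmxN -colE 2!mxE oppr_gt0.
have Px : polyhedron Y sigma x by exact: (face_Vmx i).1.
(* The value 1 on active rows is a placeholder: they do not increase along [d], so only the inactive
   slacks, positive by [active_Vmx], limit the step. *)
pose s j := if j \in enum_val i then 1 else sigma j 0 - (Y *m x) j 0.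
have s0 j : 0 < s j.
  rewrite /s; case: ifPn => // ji; rewrite subr_gt0 lt_neqAle Px andbT.
  by move: ji; rewrite -active_Vmx inE.
have [t t0 ts] := exists_step (fun j => (Y *m d) j 0) s0.
suff /imax : polyhedron Y sigma (x + t *: d).
  by rewrite dotDZr gerDl leNgt mulr_gt0.
move=> j; rewrite mulmxDr -scalemxAr mxE [X in _ + X]mxE.
have := ts j; rewrite /s; case: ifPn => ji; last by rewrite -lerBrDl.
move=> _; rewrite -[leRHS]addr0 lerD//.
rewrite mulr_ge0_le0 ?(ltW t0)//.
move/matrixP: Yd => /(_ (enum_rank_in ji j) 0).
rewrite mul_rowsub_mx mxE enum_rankK_in// => ->.
by rewrite !mxE oppr_le0 ler0n.
Qed.

Lemma polyhedron_sub_conv y x : polyhedron Y y x ->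
  conv_family (fun i => Vmx i *m y) x.
Proof.
move=> Px; have [//|[c cx]] := conv_family_or_separated (fun i => Vmx i *m y) x.
(* The cone representation is found on [P(Y, sigma)] but does not involve the right-hand side, so it
   applies to [y]. *)
have [i [a a0 cE]] := vertex_cone c.
have /= := cx i; rewrite ltNge cE -!(mulmxA a) rows_in_Vmx => /negP[].
rewrite mxE [leRHS]mxE; apply: ler_sum => k _; rewrite ler_wpM2l//.
by rewrite mul_rowsub_mx !mxE; have := Px (enum_val k); rewrite mxE.
Qed.

End simple_polytope.

(** * The configuration cone and convex combinations *)

Lemma config_cone_vertex (R : realType) m n (Y : 'M[R]_(m, n)) (sigma y : 'cV[R]_m)
    (i : 'I_#|vertex_sets Y sigma|) :
  config_cone Y sigma y -> polyhedron Y y (Vmx i *m y).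
Proof.
(* [tagnat.Rank i j] locates row [j] of the [i]-th block, where the cone inequality reads
   [Y V_i y <= y]. *)
move=> yE j; have := yE (tagnat.Rank i j).
rewrite /config_mx mxcol_mul.
have := congr1 (fun A : 'cV_m => A j 0)
  (mxcolK (fun i => (Y *m Vmx i - 1%:M) *m y) i).
rewrite mxE => ->.
by rewrite mulmxBl mul1mx -mulmxA [leRHS]mxE mxE [X in _ + X]mxE subr_le0.
Qed.

(** Induction on the number of points: the first is split off and the other weights are divided by
    their sum [s]; if [s = 0], the combination is the first point. *)
Lemma convex_set_sum (R : realType) n (U : set 'cV[R]_n) :
  convex_set (U : set (convex_lmodType 'cV[R]_n)) ->
  forall k (v : 'I_k -> 'cV[R]_n), (forall i, U (v i)) ->
  conv_family v `<=` U.
Proof.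
move=> cU; elim=> [|k IHk] v Uv _ [a [a0 a1 ->]].
  by move: a1; rewrite big_ord0 => /esym/eqP; rewrite oner_eq0.
have := a1; rewrite !big_ord_recl; set s := (X in _ + X) => as1.
have s0 : 0 <= s by exact: sumr_ge0.
have [s00|sN0] := eqVneq s 0.
  rewrite big1 => [|i _].
    by move: as1; rewrite s00 !addr0 => ->; rewrite scale1r.
  by rewrite (psumr_eq0P _ s00)// scale0r.
have Uw : U (\sum_(i < k) (a (lift ord0 i) / s) *: v (lift ord0 i)).
  apply: (IHk (fun i => v (lift ord0 i))) => //.
  exists (fun i => a (lift ord0 i) / s); split=> // [i|].
    by rewrite divr_ge0.
  by rewrite -mulr_suml divff.
have a01 : 0 <= a ord0 <= 1 by rewrite a0/= -as1 lerDl.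
have := cU (v ord0) _ (Itv01 (a0 ord0) (andP a01).2) (mem_set (Uv _)) (mem_set Uw).
rewrite inE; congr (U _).
rewrite /conv/= /unstable.onem -as1 addrAC subrr add0r; congr (_ + _).
rewrite scaler_sumr; apply: eq_bigr => i _.
by rewrite scalerA mulrC divfK.
Qed.

Lemma polyhedron_conv (R : realType) m n (Y : 'M[R]_(m, n)) y k
    (v : 'I_k -> 'cV[R]_n) :
  (forall i, polyhedron Y y (v i)) -> conv_family v `<=` polyhedron Y y.
Proof.
move=> Pv _ [a [a0 a1 ->]] j; rewrite mulmx_sumr summxE.
rewrite -[leRHS]mul1r -a1 mulr_suml; apply: ler_sum => i _.
by rewrite -scalemxAr mxE ler_wpM2l//; exact: Pv.
Qed.

(** Weights summing to 1 also distribute the constant [z]. *)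
Lemma affine_conv (R : realType) n p q k (t : 'I_k -> R) (M : 'M[R]_(q, n))
    (N : 'M[R]_(q, p)) (x : 'I_k -> 'cV[R]_n) (u : 'I_k -> 'cV[R]_p) z :
  \sum_i t i = 1 ->
  M *m (\sum_i t i *: x i) + N *m (\sum_i t i *: u i) + z =
  \sum_i t i *: (M *m x i + N *m u i + z).
Proof.
move=> t1; rewrite -[z in LHS]scale1r -t1 scaler_suml !mulmx_sumr -!big_split/=.
by apply: eq_bigr => i _; rewrite -!scalemxAr !scalerDr.
Qed.

(** * Equivalence of the two conditions *)

Theorem corollary4 (R : realType) (nx nu nw m l : nat)
  (U : set 'cV[R]_nu) (closedU : closed U)
  (convexU : convex_set (U : set (convex_lmodType 'cV[R]_nu)))
  (W : set 'cV[R]_nw) (W_neq0 : W !=set0) (compactW : compact W)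
  (C : 'M[R]_(nx, nw))
  (Abar : 'I_l -> 'M[R]_nx) (Bbar : 'I_l -> 'M[R]_(nx, nu))
  (Y : 'M[R]_(m, nx)) (sigma : 'cV[R]_m)
  (P_neq0 : polyhedron Y sigma !=set0)
  (P_bounded : bounded_set (polyhedron Y sigma))
  (P_simple : entirely_simple Y sigma)
  (y yp : 'cV[R]_m)
  (hy : config_cone Y sigma y) (hyp : config_cone Y sigma yp) :
  robust_successors U W C (mx_polytope Abar Bbar) (polyhedron Y y)
    (polyhedron Y yp)
  <-> robust_pairs U W C Abar Bbar Y sigma (y, yp).
Proof.
split=> [succ|[_ _ [u [Uu uP]]]]; last first.
  move=> x /(polyhedron_sub_conv P_simple P_neq0 P_bounded)[t [t0 t1 xE]].
  exists (\sum_i t i *: u i).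
    by apply: (convex_set_sum convexU Uu); exists t.
  move=> A B [a [a0 a1]] ABE w Ww.
  have [-> ->] : A = \sum_j a j *: Abar j /\ B = \sum_j a j *: Bbar j.
    split; [rewrite -[LHS](row_mxKl A B)|rewrite -[LHS](row_mxKr A B)];
      rewrite ABE linear_sum/=; apply: eq_bigr => j _.
      by rewrite linearZ/= row_mxKl.
    by rewrite linearZ/= row_mxKr.
  set v := \sum_i _ *: u i.
  (* The same input [v] serves every [j], so by convexity in [[A, B]] the vertices of the matrix
     polytope suffice. *)
  suff Pj j : polyhedron Y yp (Abar j *m x + Bbar j *m v + C *m w).
    apply: (polyhedron_conv Pj); exists a; split=> //.
    rewrite !mulmx_suml -[C *m w in LHS]scale1r -a1 scaler_suml -!big_split/=.
    by apply: eq_bigr => j _; rewrite -!scalemxAl !scalerDr.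
  rewrite xE affine_conv//.
  have Pi i : polyhedron Y yp (Abar j *m (Vmx i *m y) + Bbar j *m u i + C *m w).
    move=> k; apply: le_trans (uP i j k).
    rewrite !mulmxDr !mulmxA mxE [leRHS]mxE lerD2l.
    have [_ /(_ _ Ww)] := wbar_max Y C k W_neq0 compactW.
    by rewrite -!row_mul mxE.
  by apply: (polyhedron_conv Pi); exists t.
split=> //.
have exu (i : 'I_#|vertex_sets Y sigma|) : exists u, U u /\ forall A B,
    mx_polytope Abar Bbar (row_mx A B) -> forall w, W w ->
    polyhedron Y yp (A *m (Vmx i *m y) + B *m u + C *m w).
  by have [u Uu uP] := succ _ (config_cone_vertex i hy); exists u.
have [u uP] := choice exu.
exists u; split=> [i|i j k]; first exact: (uP i).1.
(* The maximizing disturbance varies with the row [k]; this is harmless since [u i] was chosen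
   before [w]. *)
have [[w Ww wE] _] := wbar_max Y C k W_neq0 compactW.
have Dj : mx_polytope Abar Bbar (row_mx (Abar j) (Bbar j)).
  exists (fun j' => (j' == j)%:R); split=> [j'||]; first exact: ler0n.
    by rewrite (bigD1 j)//= eqxx big1 ?addr0// => i' /negPf ->.
  rewrite (bigD1 j)//= eqxx scale1r big1 ?addr0// => i' /negPf ->.
  by rewrite scale0r.
apply: le_trans ((uP i).2 _ _ Dj w Ww k).
rewrite !mulmxDr !mulmxA mxE [leRHS]mxE lerD2l.
by rewrite wE -!row_mul mxE.
Qed.
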